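(* Given $n$, there exist an $N$ (depending only on $n$) and an $\epsilon > 0$ such that whenever $0 \leq \sigma_1 \leq \cdots \leq \sigma_n < \epsilon$, there exists a polynomial map $p \colon \mathbb{C}^n \to \mathbb{C}^N$ of degree 3 (or lower) such that $p(0)=0$ and $$z \mapsto \frac{p(z)}{1+\sum_{k=1}^n \sigma_k z_k^2}$$ is a rational proper map of $\mathbb{B}_n$ to $\mathbb{B}_N$ written in lowest terms. Moreover, for the same $N$, the set of $(\sigma_1,\ldots,\sigma_n)$ with $0 \le \sigma_1 \le \cdots \le \sigma_n$ for which there exists a polynomial map $p \colon \mathbb{C}^n \to \mathbb{C}^N$ of degree 3 (or lower) such that $p(0)=0$ and $z \mapsto \frac{p(z)}{1+\sum_{k=1}^n \sigma_k z_k^2}$ is a rational proper map of $\mathbb{B}_n$ to $\mathbb{B}_N$ written in lowest terms is a semialgebraic set.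
   Context: $\mathbb{B}_n \subset \mathbb{C}^n$ denotes the open unit ball. A rational map $\frac{p}{g}$, with $p\colon \mathbb{C}^n\to\mathbb{C}^N$ and $g \colon \mathbb{C}^n \to \mathbb{C}$ polynomial, is written in lowest terms if $g$ and the components of $p$ have no common nonconstant polynomial factor. It is a rational proper map of $\mathbb{B}_n$ to $\mathbb{B}_N$ if it is holomorphic on $\mathbb{B}_n$, maps $\mathbb{B}_n$ into $\mathbb{B}_N$, and is proper. A semialgebraic set is a subset of $\mathbb{R}^m$ given by finitely many polynomial equalities and inequalities (i.e. a finite Boolean combination of such conditions). *)

(* Defs.v *)
From HB Require Import structures.
From mathcomp Require Import all_boot all_order all_algebra.
From mathcomp Require Import all_classical all_reals all_analysis.
From mathcomp Require Import complex.
(* The notations of mpoly clash with those of mathcomp-analysis. *)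
From mathcomp Require Import -(notations) mpoly.
Set Implicit Arguments.
Unset Strict Implicit.
Unset Printing Implicit Defensive.
Import Order.TTheory GRing.Theory Num.Theory.
Import numFieldNormedType.Exports.
Local Open Scope classical_set_scope.
Local Open Scope ring_scope.
Local Open Scope complex_scope.

Notation "{ 'mpoly' T [ n ] }" := (mpoly n T) : type_scope.

(* The codomain [numClosedFieldType] makes the canonical topology and normed
   module structure over itself (numFieldNormedType) apply to [CC R]; the bare
   type [R[i]] only carries its R-module structure. *)
Definition CC (R : realType) : numClosedFieldType := R[i].

Definition peval (K : comNzRingType) (n : nat) (q : {mpoly K[n]})
  (x : 'rV[K]_n) : K := meval (fun i => x ord0 i) q.

(* The order on [CC R] is the partial order of numClosedFieldType, for which
   [z < 1] means that z is real and less than 1. *)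
Definition unit_ball (R : realType) (n : nat) : set 'rV[CC R]_n :=
  [set z | \sum_(i < n) `|z ord0 i| ^+ 2 < 1].

Definition mpoly_dvd (K : comNzRingType) (n : nat) (d q : {mpoly K[n]}) : Prop :=
  exists r : {mpoly K[n]}, q = d * r.

Section RationalMaps.
Variables (R : realType) (n N : nat).
Implicit Types (p : 'I_N -> {mpoly (CC R)[n]}) (g : {mpoly (CC R)[n]}).

(* At the zeros of g this has the junk value 0; see [rational_proper_map]. *)
Definition rational_map p g : 'rV[CC R]_n -> 'rV[CC R]_N :=
  fun z => \row_j (peval (p j) z / peval g z).

Definition lowest_terms p g : Prop :=
  forall d : {mpoly (CC R)[n]},
    mpoly_dvd d g -> (forall j, mpoly_dvd d (p j)) ->
    exists c : CC R, d = mpolyC n c.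

(* [differentiable] is Frechet differentiability over the scalar field of the
   normed modules, here the complex numbers. *)
Definition holomorphic_on (U : set 'rV[CC R]_n)
    (f : 'rV[CC R]_n -> 'rV[CC R]_N) : Prop :=
  forall z, U z -> differentiable f z.

(* Properness of the restriction of f as a map from U to V. *)
Definition proper_on (U : set 'rV[CC R]_n) (V : set 'rV[CC R]_N)
    (f : 'rV[CC R]_n -> 'rV[CC R]_N) : Prop :=
  forall K : set 'rV[CC R]_N, K `<=` V -> compact K -> compact (U `&` f @^-1` K).

(* The nonvanishing of g says that p / g is defined on the whole ball; it is
   stated separately because division by 0 is total here. *)
Definition rational_proper_map p g : Prop :=
  [/\ forall z, unit_ball z -> peval g z != 0,
      holomorphic_on (@unit_ball R n) (rational_map p g),
      forall z, unit_ball z -> unit_ball (rational_map p g z)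
    & proper_on (@unit_ball R n) (@unit_ball R N) (rational_map p g)].

(* [msize] is the degree plus one. *)
Definition poly_map_deg_le (d : nat) p : Prop :=
  forall j, (msize (p j) <= d.+1)%N.

End RationalMaps.

Definition denominator (R : realType) (n : nat) (sigma : 'rV[R]_n) :
    {mpoly (CC R)[n]} :=
  1 + \sum_(k < n) mpolyC n (sigma ord0 k)%:C * mpolyX _ (mnm1 k) ^+ 2.

Definition nonneg_nondecreasing (R : realType) (n : nat) (sigma : 'rV[R]_n) : Prop :=
  (forall k, 0 <= sigma ord0 k) /\
  (forall j k : 'I_n, (j <= k)%N -> sigma ord0 j <= sigma ord0 k).

Definition cubic_proper_numerator (R : realType) (n N : nat)
    (sigma : 'rV[R]_n) (p : 'I_N -> {mpoly (CC R)[n]}) : Prop :=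
  [/\ poly_map_deg_le 3 p,
      forall j, peval (p j) 0 = 0,
      rational_proper_map p (denominator sigma)
    & lowest_terms p (denominator sigma)].

Inductive semialgebraic (R : realType) (m : nat) : set 'rV[R]_m -> Prop :=
| semialgebraic_eq0 (q : {mpoly R[m]}) : semialgebraic [set x | peval q x = 0]
| semialgebraic_gt0 (q : {mpoly R[m]}) : semialgebraic [set x | 0 < peval q x]
| semialgebraicC (A : set 'rV[R]_m) : semialgebraic A -> semialgebraic (~` A)
| semialgebraicI (A B : set 'rV[R]_m) :
    semialgebraic A -> semialgebraic B -> semialgebraic (A `&` B)
| semialgebraicU (A B : set 'rV[R]_m) :
    semialgebraic A -> semialgebraic B -> semialgebraic (A `|` B).

(* Main.v *)
Require Import Defs.
From mathcomp Require Import all_boot all_order all_algebra.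
From mathcomp Require Import all_classical all_reals all_analysis.
From mathcomp Require Import complex.
From mathcomp Require Import ordered_qelim.
From mathcomp Require qe_rcf.
From mathcomp Require Import -(notations) mpoly.
From mathcomp Require Import ring lra.
Set Implicit Arguments.
Unset Strict Implicit.
Unset Printing Implicit Defensive.
Import Order.TTheory GRing.Theory Num.Theory.
Import numFieldNormedType.Exports.
Local Open Scope classical_set_scope.
Local Open Scope ring_scope.

(* Write Q = sum_k sigma_k z_k^2, S = sum_k sigma_k^2 and r = |z|^2.  The map p
   with components
     z_j (1 + 2 Q) / sqrt 2,
     sqrt (1/2 - S [j = k]) z_j z_k,
     (sigma_j z_k^2 - sigma_k z_j^2) / sqrt 2
   satisfies, by Lagrange's identity,
     |1 + Q|^2 - |p|^2 = (1 - r) (1 + 2 Re Q + 2 |Q|^2 + r / 2).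
   For small sigma the second factor lies between two positive constants on the
   ball, so p / (1 + Q) maps the ball to the ball and is proper.  A common
   divisor of all z_j (1 + 2 Q) and 1 + Q divides
   z_j = 2 z_j (1 + Q) - z_j (1 + 2 Q), hence Q, hence 1.

   For semialgebraicity, Heine-Borel turns properness of f = p / g into: for
   all rho < 1 there is s < 1 with |z|^2 <= s whenever |z| < 1 and
   |f(z)|^2 <= rho.  Coprimality only involves factors of degree at most 3.
   Hence the set is defined by a first-order formula over the reals, and
   quantifier elimination for real closed fields applies. *)

(** * Definable sets and quantifier elimination *)

Section Definable.
Variable R : realType.

(** Variables are named by a finite type; its enumeration fixes their de Bruijn positions, so
    enlarging the type enlarges the context. *)
Definition env (I : finType) (x : I -> R) : seq R := [seq x i | i <- enum I].

(** The formula may contain quantifiers and real constants; quantifiers are eliminated only once, in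
    [definable_semialgebraic]. *)
Definition definable (I : finType) (P : (I -> R) -> Prop) : Prop :=
  exists f : ord.formula R, forall x, P x <-> ord.holds (env x) f.

(* Generating these functions inductively, instead of as values of terms, makes
   adding quantified variables to the context a mere reindexing. *)
Inductive polyfun (I : finType) : ((I -> R) -> R) -> Prop :=
| polyfun_cst c : polyfun (fun=> c)
| polyfun_var i : polyfun (fun x => x i)
| polyfunD F G : polyfun F -> polyfun G -> polyfun (fun x => F x + G x)
| polyfunM F G : polyfun F -> polyfun G -> polyfun (fun x => F x * G x).

Section Closure.
Variable I : finType.
Implicit Types (P Q : (I -> R) -> Prop) (F G : (I -> R) -> R).

Lemma polyfun_term F : polyfun F ->
  exists t : GRing.term R, forall x, F x = GRing.eval (env x) t.
Proof.
elim=> [c|i|{}F G _ [s Fs] _ [t Gt]|{}F G _ [s Fs] _ [t Gt]].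
- by exists (GRing.Const c).
- exists (GRing.Var _ (index i (enum I))) => x /=.
  by rewrite (nth_map i) ?nth_index ?index_mem ?mem_enum.
- by exists (GRing.Add s t) => x /=; rewrite Fs Gt.
- by exists (GRing.Mul s t) => x /=; rewrite Fs Gt.
Qed.

Lemma polyfun_reindex (J : finType) (h : I -> J) F :
  polyfun F -> polyfun (fun x : J -> R => F (x \o h)).
Proof.
elim=> [c|i|{}F G _ Fh _ Gh|{}F G _ Fh _ Gh].
- exact: polyfun_cst.
- exact: polyfun_var.
- exact: polyfunD.
- exact: polyfunM.
Qed.

Lemma polyfunN F : polyfun F -> polyfun (fun x => - F x).
Proof.
move=> Fp; under eq_fun do rewrite -mulN1r.
by apply: polyfunM Fp; exact: polyfun_cst.
Qed.

Lemma polyfun_sum (J : finType) (A : pred J) (F : J -> (I -> R) -> R) :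
  (forall j, polyfun (F j)) -> polyfun (fun x => \sum_(j | A j) F j x).
Proof.
move=> Fp; elim: (index_enum J) => [|j s IHs].
  by under eq_fun do rewrite big_nil; exact: polyfun_cst.
by under eq_fun do rewrite big_cons; case: (A j) => //; exact: polyfunD.
Qed.

Lemma definable_eq F G :
  polyfun F -> polyfun G -> definable (fun x => F x = G x).
Proof.
move=> /polyfun_term[s Fs] /polyfun_term[t Gt].
by exists (ord.Equal s t) => x /=; rewrite Fs Gt.
Qed.

Lemma definable_lt F G :
  polyfun F -> polyfun G -> definable (fun x => F x < G x).
Proof.
move=> /polyfun_term[s Fs] /polyfun_term[t Gt].
by exists (ord.Lt s t) => x /=; rewrite Fs Gt.
Qed.

Lemma definable_le F G :
  polyfun F -> polyfun G -> definable (fun x => F x <= G x).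
Proof.
move=> /polyfun_term[s Fs] /polyfun_term[t Gt].
by exists (ord.Le s t) => x /=; rewrite Fs Gt.
Qed.

Lemma definable_iff P Q : (forall x, P x <-> Q x) -> definable P -> definable Q.
Proof. by move=> PQ [f Pf]; exists f => x; rewrite -PQ. Qed.

Lemma definable_not P : definable P -> definable (fun x => ~ P x).
Proof. by move=> [f Pf]; exists (ord.Not f) => x /=; rewrite Pf. Qed.

Lemma definable_and P Q :
  definable P -> definable Q -> definable (fun x => P x /\ Q x).
Proof.
by move=> [f Pf] [h Qh]; exists (ord.And f h) => x /=; rewrite Pf Qh.
Qed.

Lemma definable_imp P Q :
  definable P -> definable Q -> definable (fun x => P x -> Q x).
Proof.
by move=> [f Pf] [h Qh]; exists (ord.Implies f h) => x /=; rewrite Pf Qh.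
Qed.

Lemma definable_cst (A : Prop) : definable (fun _ : I -> R => A).
Proof. by exists (ord.Bool `[< A >]) => x /=; split=> /asboolP. Qed.

Lemma definable_fin_forall (J : finType) (P : J -> (I -> R) -> Prop) :
  (forall j, definable (P j)) -> definable (fun x => forall j, P j x).
Proof.
move=> Pd.
suff: definable (fun x => forall j, j \in enum J -> P j x).
  apply: definable_iff => x.
  by split=> [h j|h j _]; apply: h; rewrite ?mem_enum.
elim: (enum J) => [|j s IHs].
  by apply: (definable_iff _ (definable_cst True)) => x; split.
apply: (definable_iff _ (definable_and (Pd j) IHs)) => x; split.
  by move=> [Pj Ps] k; rewrite in_cons => /predU1P[->|/Ps].
by move=> h; split=> [|k ks]; apply: h; rewrite in_cons ?eqxx // ks orbT.
Qed.

End Closure.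

(** The quantifiers bind the indices just past the end of [e], outermost first, so the chosen values
    are appended to [e] in order. *)
Lemma holds_foldr_exists (e : seq R) (f : ord.formula R) l :
  ord.holds e (foldr ord.Exists f (iota (size e) l)) <->
  exists2 s, size s = l & ord.holds (e ++ s) f.
Proof.
elim: l e => [|l IHl] e /=.
  split=> [ef|[s /size0nil->]]; last by rewrite cats0.
  by exists [::]; rewrite ?cats0.
(* Writing at position [size e] is exactly one past the end, hence it pads with no default value. *)
have push x : set_nth 0 e (size e) x = rcons e x.
  by elim: e => //= a e ->.
split=> [[x]|[[|x s] // [sl] efs]].
  rewrite push -(size_rcons e x) => /IHl[s sl efs].
  by exists (x :: s); rewrite /= ?sl // -cat_rcons.
exists x; rewrite push -(size_rcons e x).
by apply/IHl; exists s; rewrite // cat_rcons.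
Qed.

(** * Quantification over finite families of real variables *)

Section Quantifiers.
Variables I J : finType.
Implicit Type P : (I -> R) -> (J -> R) -> Prop.

(** The enumeration of a sum type lists the left summand first, so the variables indexed by [J] sit
    behind the context [I], where [holds_foldr_exists] binds them. *)
Lemma env_sum (v : I + J -> R) : env v = env (v \o inl) ++ env (v \o inr).
Proof. by rewrite /env enumT unlock /= map_cat -!map_comp -!enumT. Qed.

Lemma definable_exists P :
  definable (fun v : I + J -> R => P (v \o inl) (v \o inr)) ->
  definable (fun x => exists y, P x y).
Proof.
move=> [f Pf]; exists (foldr ord.Exists f (iota #|I| #|J|)) => x.
have -> : #|I| = size (env x) by rewrite size_map cardE.
rewrite holds_foldr_exists; split=> [[y Pxy]|[s sJ xsf]].
  exists (env y); first by rewrite size_map cardE.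
  have /= := Pf (fun k => match k with inl i => x i | inr j => y j end).
  by rewrite env_sum => -[/(_ Pxy)].
(* The list of values found by the formula is read back as a family through the ranks in [J]. *)
pose y (j : J) : R := s`_(enum_rank j).
exists y.
have /= := Pf (fun k => match k with inl i => x i | inr j => y j end).
rewrite env_sum => -[_]; apply.
suff -> : env y = s by [].
apply: (@eq_from_nth _ 0); first by rewrite size_map -cardE.
rewrite size_map -cardE => k kJ; rewrite -[k]/(val (Ordinal kJ)).
rewrite (nth_map (enum_val (Ordinal kJ))) -?cardE ?ltn_ord //.
by rewrite -enum_val_nth /y enum_valK.
Qed.

Lemma definable_forall P :
  definable (fun v : I + J -> R => P (v \o inl) (v \o inr)) ->
  definable (fun x => forall y, P x y).
Proof.
move=> /definable_not /(definable_exists (P := fun x y => ~ P x y)).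
move=> /definable_not.
apply: definable_iff => x; split=> [nex y|h [y]]; last exact.
by apply: contrapT => nP; apply: nex; exists y.
Qed.

End Quantifiers.

Lemma definable_exists1 (I : finType) (P : (I -> R) -> R -> Prop) :
  definable (fun v : I + unit -> R => P (v \o inl) (v (inr tt))) ->
  definable (fun x => exists r, P x r).
Proof.
move=> /(definable_exists (P := fun x y => P x (y tt))).
apply: definable_iff => x; split=> [[y Py]|[r Pr]]; first by exists (y tt).
by exists (fun=> r).
Qed.

Lemma definable_forall1 (I : finType) (P : (I -> R) -> R -> Prop) :
  definable (fun v : I + unit -> R => P (v \o inl) (v (inr tt))) ->
  definable (fun x => forall r, P x r).
Proof.
move=> /(definable_forall (P := fun x y => P x (y tt))).
apply: definable_iff => x.
by split=> [h r|h y]; [exact: (h (fun=> r))|exact: h].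
Qed.

(** * From formulas to semialgebraic sets *)

Lemma rterm_mpoly m (t : GRing.term R) : GRing.rterm t ->
  exists q : {mpoly R[m]}, forall x : 'I_m -> R,
    GRing.eval (env x) t = meval x q.
Proof.
elim: t => //=.
- move=> k _; case: (ltnP k m) => km.
    exists (mpolyX _ (mnm1 (Ordinal km))) => x; rewrite mevalXU.
    rewrite (nth_map (Ordinal km)) ?size_enum_ord //.
    by rewrite (nth_ord_enum (Ordinal km) (Ordinal km)).
  (* A variable beyond the context evaluates to the default value 0 of [nth]. *)
  by exists 0 => x; rewrite meval0 nth_default // size_map size_enum_ord.
- by move=> c _; exists (mpolyC m c) => x; rewrite mevalC.
- by move=> k _; exists (mpolyC m k%:R) => x; rewrite mevalC.
- move=> s IHs t IHt /andP[/IHs[p sp] /IHt[q tq]]; exists (p + q) => x.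
  by rewrite mevalD sp tq.
- by move=> s IHs /IHs[p sp]; exists (- p) => x; rewrite mevalN sp.
- by move=> s IHs k /IHs[p sp]; exists (p *+ k) => x; rewrite mevalMn sp.
- move=> s IHs t IHt /andP[/IHs[p sp] /IHt[q tq]]; exists (p * q) => x.
  by rewrite mevalM sp tq.
- move=> s IHs k /IHs[p sp]; exists (p ^+ k) => x.
  by rewrite rmorphXn /= sp.
Qed.

(** Quantifier elimination over a real closed field leaves a Boolean combination of atoms between
    inverse-free terms. Such terms are polynomials, and the connectives match the constructors of
    [semialgebraic]. *)
Lemma definable_semialgebraic m (P : ('I_m -> R) -> Prop) :
  definable P -> semialgebraic [set x : 'rV[R]_m | P (fun i => x ord0 i)].
Proof.
move=> [f Pf].
pose sat h := [set x : 'rV[R]_m | ord.qf_eval (env (fun i => x ord0 i)) h].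
pose wproj k s := qe_rcf.qfr_to_formula (@qe_rcf.wproj R k s).
have -> : [set x : 'rV[R]_m | P (fun i => x ord0 i)] =
    sat (ord.quantifier_elim wproj (ord.to_rform f)).
  apply/seteqP; split=> x /=; first by move=> /Pf/qe_rcf.rcf_satP.
  by move=> /qe_rcf.rcf_satP/Pf.
(* The eliminated formula is quantifier-free and contains neither inverses nor unit tests; this
   rules out the remaining constructors in the induction. *)
have /andP[] := ord.quantifier_elim_wf (@qe_rcf.wf_QE_wproj R)
  (ord.to_rform_rformula f).
rewrite -/wproj /sat.
elim: (ord.quantifier_elim _ _) => //=.
- case=> _ _.
    rewrite (_ : [set _ | _] = [set x : 'rV[R]_m | peval 0 x = 0]).
      exact: semialgebraic_eq0.
    by apply/seteqP; split=> x //= _; rewrite /peval meval0.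
  rewrite (_ : [set _ | _] = [set x : 'rV[R]_m | 0 < peval 0 x]).
    exact: semialgebraic_gt0.
  by apply/seteqP; split=> x //=; rewrite /peval meval0 ltxx.
- move=> s t _ /andP[/(rterm_mpoly m)[p sp] /(rterm_mpoly m)[q tq]].
  rewrite (_ : [set _ | _] = [set x : 'rV[R]_m | peval (p - q) x = 0]).
    exact: semialgebraic_eq0.
  apply/seteqP; split=> x /=; rewrite /peval mevalB sp tq.
    by move=> /eqP ->; rewrite subrr.
  by move=> /eqP; rewrite subr_eq0.
- move=> s t _ /andP[/(rterm_mpoly m)[p sp] /(rterm_mpoly m)[q tq]].
  rewrite (_ : [set _ | _] = [set x : 'rV[R]_m | 0 < peval (q - p) x]).
    exact: semialgebraic_gt0.
  by apply/seteqP; split=> x /=; rewrite /peval mevalB sp tq subr_gt0.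
- move=> s t _ /andP[/(rterm_mpoly m)[p sp] /(rterm_mpoly m)[q tq]].
  (* A weak inequality is the complement of the reversed strict one. *)
  rewrite (_ : [set _ | _] = ~` [set x : 'rV[R]_m | 0 < peval (p - q) x]).
    exact/semialgebraicC/semialgebraic_gt0.
  apply/seteqP; split=> x /=; rewrite /peval mevalB sp tq subr_gt0 leNgt.
    by move/negP.
  by move=> /negP.
- move=> f1 IH1 f2 IH2 /andP[q1 q2] /andP[r1 r2].
  rewrite (_ : [set _ | _] = sat f1 `&` sat f2).
    by apply: semialgebraicI; [exact: IH1|exact: IH2].
  by apply/seteqP; split=> x /= /andP.
- move=> f1 IH1 f2 IH2 /andP[q1 q2] /andP[r1 r2].
  rewrite (_ : [set _ | _] = sat f1 `|` sat f2).
    by apply: semialgebraicU; [exact: IH1|exact: IH2].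
  by apply/seteqP; split=> x /= /orP.
- move=> f1 IH1 f2 IH2 /andP[q1 q2] /andP[r1 r2].
  rewrite (_ : [set _ | _] = ~` sat f1 `|` sat f2).
    by apply: semialgebraicU; [apply: semialgebraicC; exact: IH1|exact: IH2].
  apply/seteqP; split=> x /=; rewrite implybE.
    by move=> /orP[/negP|]; [left|right].
  by move=> [/negP ->|->]; rewrite ?orbT.
- move=> f1 IH1 q1 r1.
  rewrite (_ : [set _ | _] = ~` sat f1).
    by apply: semialgebraicC; exact: IH1.
  by apply/seteqP; split=> x /= /negP.
Qed.

End Definable.

Local Open Scope complex_scope.

(** * Topology of the complex unit ball *)

Section SquaredNorm.
Variable R : realType.

(** The squared modulus taken in [R], as a polynomial in the real and imaginary parts: this serves
    both the real order and definability. *)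
Definition nsq (z : CC R) : R := complex.Re z ^+ 2 + complex.Im z ^+ 2.

Lemma normr2_nsq (z : CC R) : `|z| ^+ 2 = (nsq z)%:C.
Proof. by rewrite -(add_Re2_Im2 (z : R[i])). Qed.

Lemma nsq_ge0 (z : CC R) : 0 <= nsq z.
Proof. by rewrite addr_ge0 // sqr_ge0. Qed.

Lemma nsqM (z w : CC R) : nsq (z * w) = nsq z * nsq w.
Proof.
by apply: (@complexI R); rewrite rmorphM /= -!normr2_nsq normrM exprMn.
Qed.

Lemma nsqV (z : CC R) : nsq z^-1 = (nsq z)^-1.
Proof.
by apply: (@complexI R); rewrite fmorphV /= -!normr2_nsq normfV exprVn.
Qed.

Lemma nsq_eq0 (z : CC R) : (nsq z == 0) = (z == 0).
Proof.
by rewrite -(inj_eq (@complexI R)) rmorph0 /= -normr2_nsq sqrf_eq0 normr_eq0.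
Qed.

Definition rnsq n (z : 'rV[CC R]_n) : R := \sum_i nsq (z ord0 i).

Lemma rnsq_ge0 n (z : 'rV[CC R]_n) : 0 <= rnsq z.
Proof. by apply: sumr_ge0 => i _; exact: nsq_ge0. Qed.

Lemma unit_ballE n (z : 'rV[CC R]_n) : unit_ball z <-> rnsq z < 1.
Proof.
rewrite /unit_ball /= -ltcR -[(1 : R)%:C]/(1 : R[i]) rmorph_sum /=.
by under eq_bigr do rewrite normr2_nsq.
Qed.

Lemma real_complex_continuous : continuous (fun x : R => x%:C : CC R).
Proof.
move=> x; apply/cvgrPdist_lt => /= e e0.
(* A positive element of [CC R] is real, so the tolerance may be replaced by its real part. *)
have eE : e = (complex.Re (e : R[i]))%:C.
  by rewrite RRe_real // realE ltW.
have e0' : 0 < complex.Re (e : R[i]) by rewrite -ltcR -eE.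
have : \forall t \near x, `|x - t| < complex.Re (e : R[i]).
  by move/cvgrPdist_lt: (@cvg_id _ (nbhs x)) => /(_ _ e0').
apply: filterS => t xt; rewrite eE -rmorphB /= normc_def /= expr0n addr0.
by rewrite sqrtr_sqr ltcR.
Qed.

(** Such a map is 1-Lipschitz; the lemma serves for the real and imaginary parts. *)
Lemma contracting_continuous (f : CC R -> R) :
  {morph f : z w / z - w} -> (forall z, `|f z|%:C <= `|z|) -> continuous f.
Proof.
move=> fB f_le z; have F : Filter (nbhs z) by exact: nbhs_filter.
apply/cvgrPdist_lt => /= e e0.
have e0' : (0 : CC R) < e%:C by rewrite ltcR.
have := nbhsx_ballx z _ e0'; rewrite -ball_normE.
apply: filterS => t /= zt; rewrite -ltcR.
by apply: le_lt_trans zt; rewrite -fB.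
Qed.

Lemma Re_continuous : continuous (fun z : CC R => complex.Re z).
Proof.
apply: contracting_continuous => [z w|z]; first by case: z w => [a b] [c d].
exact: (normc_ge_Re (z : R[i])).
Qed.

Lemma Im_continuous : continuous (fun z : CC R => complex.Im z).
Proof.
apply: contracting_continuous => [z w|z]; first by case: z w => [a b] [c d].
by rewrite normc_def lecR -sqrtr_sqr ler_wsqrtr // lerDr sqr_ge0.
Qed.

Lemma nsq_continuous : continuous nsq.
Proof.
move=> z; have F : Filter (nbhs z) by exact: nbhs_filter.
by apply: cvgD; apply: cvgM; [exact: Re_continuous|exact: Re_continuous
  |exact: Im_continuous|exact: Im_continuous].
Qed.

Lemma rnsq_continuous n : continuous (@rnsq n).
Proof.
rewrite /rnsq; elim: (index_enum _) => [|i s IHs].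
  by under [X in continuous X]eq_fun do rewrite big_nil; exact: cst_continuous.
under [X in continuous X]eq_fun do rewrite big_cons.
move=> z; have F : Filter (nbhs z) by exact: nbhs_filter.
apply: cvgD; last exact: IHs.
apply: (@continuous_comp _ _ _ (fun z : 'rV[CC R]_n => z ord0 i) nsq).
  exact: coord_continuous.
exact: nsq_continuous.
Qed.

(** The box is the continuous image of a square in the real plane, a product of two segments. *)
Lemma box_compact (M : R) :
  compact [set z : CC R | `|complex.Re z| <= M /\ `|complex.Im z| <= M].
Proof.
pose f (u : R * R) : CC R := u.1%:C + 'i%C * u.2%:C.
have fE u : f u = Complex u.1 u.2 by rewrite [RHS]complexE.
have -> : [set z : CC R | `|complex.Re z| <= M /\ `|complex.Im z| <= M] =
    f @` (`[- M, M]%classic `*` `[- M, M]%classic).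
  apply/seteqP; split=> [[a b] /= [aM bM]|_ [[a b] /= [aM bM]] <-].
    exists (a, b); first by rewrite /= !in_itv /= -!ler_norml.
    exact: fE.
  by move: aM bM; rewrite !in_itv -!ler_norml; split; rewrite fE.
apply: continuous_compact.
  apply: continuous_subspaceT => u; apply: cvgD.
    apply: (@continuous_comp _ _ _ fst (fun x : R => x%:C : CC R)).
      exact: cvg_fst.
    exact: real_complex_continuous.
  apply: cvgM; first exact: cvg_cst.
  apply: (@continuous_comp _ _ _ snd (fun x : R => x%:C : CC R)).
    exact: cvg_snd.
  exact: real_complex_continuous.
by apply: compact_setX; exact: segment_compact.
Qed.

(** The set is closed, and it lies in a product of compact boxes. The side [rho + 1] avoids a square
    root: [2 * |x| <= x ^+ 2 + 1]. *)
Lemma closed_ball_compact n (rho : R) :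
  compact [set z : 'rV[CC R]_n | rnsq z <= rho].
Proof.
pose M := rho + 1.
apply: (@subclosed_compact _ _ [set z : 'rV[CC R]_n |
    forall i, [set w : CC R | `|complex.Re w| <= M /\ `|complex.Im w| <= M]
      (z ord0 i)]).
- apply: (@preimage_closed _ _ (@rnsq n) [set x | x <= rho]).
    by move=> z _; exact: rnsq_continuous.
  exact: closed_le.
- exact: (@rV_compact (CC R) n (fun=> [set w | _])
    (fun=> @box_compact M)).
move=> z /= zrho i.
have zi : nsq (z ord0 i) <= rho.
  apply: le_trans zrho; rewrite /rnsq (bigD1 i) //= lerDl.
  by apply: sumr_ge0 => j _; exact: nsq_ge0.
have sq (x y : R) : x ^+ 2 + y ^+ 2 <= rho -> `|x| <= M.
  move=> h; rewrite -real_normK ?num_real // in h.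
  have := sqr_ge0 y; have := sqr_ge0 (`|x| - 1); rewrite /M.
  have := normr_ge0 x.
  nra.
split; first exact: (sq _ _ zi).
by apply: (sq _ (complex.Re (z ord0 i))); rewrite addrC.
Qed.

(** The maximum of [rnsq] on [K] is attained at a point of [K], hence inside the open ball. *)
Lemma compact_sub_ball_le n (K : set 'rV[CC R]_n) :
  compact K -> K `<=` @unit_ball R n ->
  exists2 s : R, s < 1 & forall z, K z -> rnsq z <= s.
Proof.
move=> cK Kball; have [K0|/set0P K0] := eqVneq K set0.
  by exists 0 => // z; rewrite K0.
have [w /set_mem Kw wmax] := compact_EVT_max K0 cK
  (continuous_subspaceT (@rnsq_continuous n)).
exists (rnsq w); first exact/unit_ballE/Kball.
by move=> z Kz; apply: wmax; exact/mem_set.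
Qed.

(** Closed balls of squared radius below 1 exhaust the unit ball by compact sets. Forwards, the
    preimage of such a ball is compact and so stays away from the sphere; backwards, the preimage of
    [K] is a closed subset of such a ball. *)
Lemma proper_onP n N (f : 'rV[CC R]_n -> 'rV[CC R]_N) :
  (forall z, unit_ball z -> {for z, continuous f}) ->
  (forall z, unit_ball z -> unit_ball (f z)) ->
  proper_on (@unit_ball R n) (@unit_ball R N) f <->
  (forall rho : R, rho < 1 -> exists2 s : R, s < 1 &
     forall z, rnsq z < 1 -> rnsq (f z) <= rho -> rnsq z <= s).
Proof.
move=> cf fball; split=> [pf rho rho1|h K Kball cK].
  have cP : compact (@unit_ball R n `&` f @^-1` [set w | rnsq w <= rho]).
    apply: pf (@closed_ball_compact N rho) => w /= wrho.
    exact/unit_ballE/(le_lt_trans wrho).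
  have [z []//|s s1 hs] := compact_sub_ball_le cP.
  exists s => // z z1 fz; apply: hs; split => //.
  exact/unit_ballE.
have [rho rho1 Krho] := compact_sub_ball_le cK Kball.
have [s s1 hs] := h _ rho1.
have sub z : unit_ball z -> K (f z) -> rnsq z <= s.
  by move=> /unit_ballE z1 Kfz; apply: hs => //; exact: Krho.
have sball (z : 'rV[CC R]_n) : rnsq z <= s -> unit_ball z.
  by move=> zs; apply/unit_ballE/(le_lt_trans zs).
apply: (@subclosed_compact _ _ [set z | rnsq z <= s]).
(* A limit point of the preimage still satisfies [rnsq z <= s], so it lies in the ball, where [f] is
   continuous; were [f z] outside the closed set [K], a neighbourhood of [z] would miss the
   preimage. *)
- move=> z clz.
  have zs : rnsq z <= s.
    have cl : closed [set z : 'rV[CC R]_n | rnsq z <= s].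
      apply: (@preimage_closed _ _ (@rnsq n) [set x | x <= s]).
        by move=> w _; exact: rnsq_continuous.
      exact: closed_le.
    by apply/cl/(@closure_subset _ _ _ _ _ clz) => w [wb Kfw]; exact: sub.
  split; first exact: sball.
  apply: contrapT => nKfz.
  have cK' := compact_closed (@norm_hausdorff _ _) cK.
  have /(cf _ (sball _ zs)) : nbhs (f z) (~` K).
    by apply: open_nbhs_nbhs; split => //; exact: closed_openC.
  by move=> /clz[w [[_ Kfw]]].
- exact: closed_ball_compact.
- by move=> z [zb Kfz]; exact: sub.
Qed.

(** * Complex differentiability of rational maps *)

Section Differentiability.
Variables (n : nat) (z : 'rV[CC R]_n).

Lemma differentiable_big_sum (T : Type) (s : seq T)
    (F : T -> 'rV[CC R]_n -> CC R) :
  (forall t, differentiable (F t) z) ->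
  differentiable (fun w => \sum_(t <- s) F t w) z.
Proof.
move=> dF; elim: s => [|t s IHs].
  by under eq_fun do rewrite big_nil; exact: differentiable_cst.
by under eq_fun do rewrite big_cons; exact: differentiableD.
Qed.

Lemma differentiable_big_prod (T : Type) (s : seq T)
    (F : T -> 'rV[CC R]_n -> CC R) :
  (forall t, differentiable (F t) z) ->
  differentiable (fun w => \prod_(t <- s) F t w) z.
Proof.
move=> dF; elim: s => [|t s IHs].
  by under eq_fun do rewrite big_nil; exact: differentiable_cst.
by under eq_fun do rewrite big_cons; exact: differentiableM.
Qed.

Lemma differentiable_peval (q : {mpoly (CC R)[n]}) : differentiable (peval q) z.
Proof.
rewrite /peval; under eq_fun do rewrite mevalE.
apply: differentiable_big_sum => m.
apply: differentiableM; first exact: differentiable_cst.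
apply: differentiable_big_prod => i.
elim: (fun_of_multinom m i) => [|k IHk].
  by under eq_fun do rewrite expr0; exact: differentiable_cst.
under eq_fun do rewrite exprS.
by apply: differentiableM => //; exact: differentiable_coord.
Qed.

Lemma differentiable_rational_map N (p : 'I_N -> {mpoly (CC R)[n]}) g :
  peval g z != 0 -> differentiable (rational_map p g) z.
Proof.
move=> gz.
have -> : rational_map p g = \sum_(j < N)
    (fun w => (peval (p j) w / peval g w) *: (delta_mx ord0 j : 'rV[CC R]_N)).
  apply/funext => w; rewrite [LHS]row_sum_delta fct_sumE.
  by apply: eq_bigr => j _; rewrite mxE.
apply: differentiable_sum => j; apply: differentiableZl.
apply: differentiableM; first exact: differentiable_peval.
by apply: differentiableV => //; exact: differentiable_peval.
Qed.

End Differentiability.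

Lemma rnsq_rational_map n N (p : 'I_N -> {mpoly (CC R)[n]}) g z :
  rnsq (rational_map p g z) = (\sum_j nsq (peval (p j) z)) / nsq (peval g z).
Proof.
rewrite mulr_suml; apply: eq_bigr => j _.
by rewrite mxE nsqM nsqV.
Qed.

(** Clearing denominators leaves only polynomial inequalities under quantifiers over numbers, the
    form that both the explicit map and the definability argument need. Holomorphy is automatic
    where the denominator does not vanish. *)
Lemma rational_proper_mapP n N (p : 'I_N -> {mpoly (CC R)[n]}) g :
  rational_proper_map p g <->
  (forall z, rnsq z < 1 -> \sum_j nsq (peval (p j) z) < nsq (peval g z)) /\
  (forall rho : R, rho < 1 -> exists s : R, s < 1 /\ forall z, rnsq z < 1 ->
     \sum_j nsq (peval (p j) z) <= rho * nsq (peval g z) -> rnsq z <= s).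
Proof.
have cont z : peval g z != 0 -> {for z, continuous (rational_map p g)}.
  by move=> gz; exact/differentiable_continuous/differentiable_rational_map.
have nsq_gt0 w : w != 0 -> 0 < nsq w.
  by move=> w0; rewrite lt_neqAle eq_sym nsq_eq0 w0 nsq_ge0.
split=> [[g0 _ fball pf]|[lt_g h]].
  split=> [z z1|rho rho1].
    have zb : unit_ball z by exact/unit_ballE.
    have := fball _ zb; rewrite unit_ballE rnsq_rational_map.
    by rewrite ltr_pdivrMr ?mul1r // nsq_gt0 // g0.
  have := (@proper_onP _ _ _ _ fball).1 => /(_ _ pf _ rho1)[z zb|s s1 hs].
    exact/cont/g0.
  exists s; split=> // z z1 pg; apply: hs => //.
  have zb : unit_ball z by exact/unit_ballE.
  by rewrite rnsq_rational_map ler_pdivrMr // nsq_gt0 // g0.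
(* A sum of squares is nonnegative, so the strict inequality already forces the denominator to be
   nonzero. *)
have gz z : unit_ball z -> peval g z != 0.
  move=> /unit_ballE/lt_g; apply: contraTneq => ->; rewrite -leNgt.
  have /eqP -> : nsq 0 == 0 by rewrite nsq_eq0.
  by apply: sumr_ge0 => j _; exact: nsq_ge0.
have fball z : unit_ball z -> unit_ball (rational_map p g z).
  move=> zb; apply/unit_ballE; rewrite rnsq_rational_map.
  rewrite ltr_pdivrMr ?mul1r ?nsq_gt0 ?gz //.
  exact/lt_g/unit_ballE.
split=> //.
  by move=> z /gz; exact: differentiable_rational_map.
apply/proper_onP => // [z /gz/cont //|rho /h[s [s1 hs]]].
exists s => // z z1; rewrite rnsq_rational_map ler_pdivrMr; first exact: hs.
by apply/nsq_gt0/gz/unit_ballE.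
Qed.

End SquaredNorm.

(** * The explicit cubic map *)

Section SumsOfSquares.
Variable R : realType.

Lemma complexReD (z w : CC R) :
  complex.Re (z + w) = complex.Re z + complex.Re w.
Proof. by case: z w => [a b] [c d]. Qed.

Lemma complexImD (z w : CC R) :
  complex.Im (z + w) = complex.Im z + complex.Im w.
Proof. by case: z w => [a b] [c d]. Qed.

Lemma complexReN (z : CC R) : complex.Re (- z) = - complex.Re z.
Proof. by case: z. Qed.

Lemma complexImN (z : CC R) : complex.Im (- z) = - complex.Im z.
Proof. by case: z. Qed.

Lemma complexReM (z w : CC R) :
  complex.Re (z * w) =
    complex.Re z * complex.Re w - complex.Im z * complex.Im w.
Proof. by case: z w => [a b] [c d]. Qed.

Lemma complexImM (z w : CC R) :
  complex.Im (z * w) =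
    complex.Re z * complex.Im w + complex.Im z * complex.Re w.
Proof. by case: z w => [a b] [c d]. Qed.

Lemma complexRe_sum (I : finType) (F : I -> CC R) :
  complex.Re (\sum_i F i) = \sum_i complex.Re (F i).
Proof. by apply: (big_morph _ complexReD). Qed.

Lemma complexIm_sum (I : finType) (F : I -> CC R) :
  complex.Im (\sum_i F i) = \sum_i complex.Im (F i).
Proof. by apply: (big_morph _ complexImD). Qed.

Lemma complexReZ (a : R) (z : CC R) : complex.Re (a%:C * z) = a * complex.Re z.
Proof. by rewrite complexReM /= mul0r subr0. Qed.

Lemma complexImZ (a : R) (z : CC R) : complex.Im (a%:C * z) = a * complex.Im z.
Proof. by rewrite complexImM /= mul0r addr0. Qed.

Lemma nsq_real (a : R) : nsq (a%:C : CC R) = a ^+ 2.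
Proof. by rewrite /nsq /= expr0n addr0. Qed.

(** Expanding the square splits the double sum into products of single sums. *)
Lemma sum_lagrange (I : finType) (s a : I -> R) :
  \sum_i \sum_j (s i * a j - s j * a i) ^+ 2 =
  2 * ((\sum_i s i ^+ 2) * (\sum_i a i ^+ 2) - (\sum_i s i * a i) ^+ 2).
Proof.
have -> : \sum_i \sum_j (s i * a j - s j * a i) ^+ 2 =
    \sum_i \sum_j (s i ^+ 2 * a j ^+ 2 + a i ^+ 2 * s j ^+ 2 -
      (2 * (s i * a i)) * (s j * a j)).
  by apply: eq_bigr => i _; apply: eq_bigr => j _; ring.
under eq_bigr do rewrite sumrB big_split /=.
rewrite sumrB big_split /= -!big_distrlr /= -mulr_sumr.
ring.
Qed.

(** As the weights [s] are real, this is the real identity applied to the real and imaginary parts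
    of [w] separately. *)
Lemma nsq_lagrange (I : finType) (s : I -> R) (w : I -> CC R) :
  \sum_i \sum_j nsq ((s i)%:C * w j - (s j)%:C * w i) =
  2 * ((\sum_i s i ^+ 2) * (\sum_i nsq (w i)) - nsq (\sum_i (s i)%:C * w i)).
Proof.
rewrite {1 3}/nsq complexRe_sum complexIm_sum big_split /=.
under [X in X ^+ 2 + _]eq_bigr do rewrite complexReZ.
under [X in _ + X ^+ 2]eq_bigr do rewrite complexImZ.
under eq_bigr do under eq_bigr do
  rewrite complexReD complexImD complexReN complexImN !complexReZ !complexImZ.
under eq_bigr do rewrite big_split /=.
rewrite big_split /= !sum_lagrange.
ring.
Qed.

Lemma nsq_1D (w : CC R) : nsq (1 + w) = 1 + 2 * complex.Re w + nsq w.
Proof. by rewrite /nsq complexReD complexImD /=; ring. Qed.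

End SumsOfSquares.

(** * Degree bounds and divisibility of polynomials *)

Section PolynomialBounds.
Variables (R : realType) (n : nat).
Implicit Types p q : {mpoly (CC R)[n]}.

Lemma msizeD_bound p q d :
  (msize p <= d -> msize q <= d -> msize (p + q) <= d)%N.
Proof.
by move=> pd qd; apply: leq_trans (msizeD_le _ _) _; rewrite geq_max pd.
Qed.

Lemma msizeM_bound p q a b :
  (msize p <= a.+1 -> msize q <= b.+1 -> msize (p * q) <= (a + b).+1)%N.
Proof.
have [->|p0] := eqVneq p 0; first by rewrite mul0r msize0.
have [->|q0] := eqVneq q 0; first by rewrite mulr0 msize0.
rewrite msizeM // => pa qb; have := leq_add pa qb.
by rewrite addSn addnS; case: (_ + _)%N.
Qed.

Lemma msizeC_bound (c : CC R) d : (msize (mpolyC n c) <= d.+1)%N.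
Proof. by rewrite msizeC; case: (c != 0). Qed.

Lemma mpoly_dvdB (d p q : {mpoly (CC R)[n]}) :
  mpoly_dvd d p -> mpoly_dvd d q -> mpoly_dvd d (p - q).
Proof. by move=> [u ->] [v ->]; exists (u - v); rewrite mulrBr. Qed.

Lemma mpoly_dvdMl (d p q : {mpoly (CC R)[n]}) :
  mpoly_dvd d q -> mpoly_dvd d (p * q).
Proof. by move=> [v ->]; exists (p * v); rewrite mulrCA. Qed.

End PolynomialBounds.

(** * The cubic numerator: norm identity, properness, lowest terms *)

Section Existence.
Variables (R : realType) (n : nat) (sigma : 'rV[R]_n).

Let X (k : 'I_n) : {mpoly (CC R)[n]} := mpolyX _ (mnm1 k).

Let Q : {mpoly (CC R)[n]} := \sum_k mpolyC n (sigma ord0 k)%:C * X k ^+ 2.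

Let S : R := \sum_k sigma ord0 k ^+ 2.

(** One summand for each family of components. The number of indices, which becomes [N], depends on
    [n] alone. *)
Definition numerator_index : finType := ('I_n + 'I_n * 'I_n + 'I_n * 'I_n)%type.

Definition numerator_entry (t : numerator_index) : {mpoly (CC R)[n]} :=
  match t with
  | inl (inl j) => mpolyC n (Num.sqrt (1 / 2))%:C * (X j * (1 + Q + Q))
  | inl (inr (j, k)) =>
      mpolyC n (Num.sqrt (1 / 2 - S * (j == k)%:R))%:C * (X j * X k)
  | inr (j, k) => mpolyC n (Num.sqrt (1 / 2))%:C *
      (mpolyC n (sigma ord0 j)%:C * X k ^+ 2 -
       mpolyC n (sigma ord0 k)%:C * X j ^+ 2)
  end.

Definition numerator (j : 'I_#|numerator_index|) : {mpoly (CC R)[n]} :=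
  numerator_entry (enum_val j).

Lemma peval_quad z : peval Q z = \sum_k (sigma ord0 k)%:C * z ord0 k ^+ 2.
Proof.
rewrite /peval /Q raddf_sum; apply: eq_bigr => k _ /=.
by rewrite mevalM mevalC rmorphXn /= mevalXU.
Qed.

Lemma peval_denominator z : peval (denominator sigma) z = 1 + peval Q z.
Proof. by rewrite /peval mevalD meval1. Qed.

Lemma sum_numerator (F : {mpoly (CC R)[n]} -> R) :
  \sum_j F (numerator j) =
  \sum_j F (numerator_entry (inl (inl j))) +
  \sum_j \sum_k F (numerator_entry (inl (inr (j, k)))) +
  \sum_j \sum_k F (numerator_entry (inr (j, k))).
Proof.
rewrite /numerator -(reindex (@enum_val numerator_index numerator_index)
   (P := xpredT) (F := fun t => F (numerator_entry t))); last first.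
  exact/onW_bij/enum_val_bij.
rewrite !big_sumType /=; congr (_ + _ + _); rewrite pair_bigA /=;
  by apply: eq_bigr => -[].
Qed.

(** With [r] for [rnsq z] and [q] for the value of [Q], the three families contribute
    [r |1 + 2 q|^2 / 2], then [r^2 / 2] minus [S] times the sum of the [|z_j|^4], then that same
    multiple minus [|q|^2]. The quartic sums cancel. *)
Lemma nsq_numerator z : S <= 1 / 2 ->
  \sum_j nsq (peval (numerator j) z) =
  nsq (1 + peval Q z) - (1 - rnsq z) *
    (1 + 2 * complex.Re (peval Q z) + 2 * nsq (peval Q z) + rnsq z / 2).
Proof.
move=> S_le; rewrite (sum_numerator (fun p => nsq (peval p z))) /=.
set q := peval Q z; set x := fun k => nsq (z ord0 k).
have sq_half : Num.sqrt (1 / 2) ^+ 2 = 1 / 2 :> R by rewrite sqr_sqrtr //; lra.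
have -> : \sum_j nsq (peval (mpolyC n (Num.sqrt (1 / 2))%:C *
    (X j * (1 + Q + Q))) z) = rnsq z * (1 / 2 * nsq (1 + (q + q))).
  rewrite mulr_suml; apply: eq_bigr => j _.
  rewrite /peval !mevalM mevalC !mevalD meval1 mevalXU !nsqM nsq_real sq_half.
  by rewrite mulrCA addrA.
have -> : \sum_j \sum_k nsq (peval (mpolyC n
    (Num.sqrt (1 / 2 - S * (j == k)%:R))%:C * (X j * X k)) z) =
    1 / 2 * rnsq z ^+ 2 - S * \sum_j x j ^+ 2.
  have -> : rnsq z ^+ 2 = \sum_j \sum_k x j * x k.
    by rewrite expr2 -big_distrlr.
  rewrite !mulr_sumr -sumrB; apply: eq_bigr => j _.
  transitivity (\sum_k (1 / 2 * (x j * x k) - S * (j == k)%:R * (x j * x k))).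
    apply: eq_bigr => k _.
    rewrite /peval !mevalM mevalC !mevalXU !nsqM nsq_real.
    (* The bound on [S] makes the radicand nonnegative on the diagonal, where it equals
       [1 / 2 - S]. *)
    rewrite sqr_sqrtr ?mulrBl //; case: eqP => _; rewrite ?mulr1 ?mulr0; lra.
  rewrite sumrB; congr (_ - _); first by rewrite -!mulr_sumr.
  rewrite (bigD1 j) //= eqxx mulr1 big1 ?addr0 // => k /negbTE.
  by rewrite eq_sym => ->; rewrite mulr0 mul0r.
have -> : \sum_j \sum_k nsq (peval (mpolyC n (Num.sqrt (1 / 2))%:C *
      (mpolyC n (sigma ord0 j)%:C * X k ^+ 2 -
       mpolyC n (sigma ord0 k)%:C * X j ^+ 2)) z) =
    S * (\sum_j x j ^+ 2) - nsq q.
  have -> : S * (\sum_j x j ^+ 2) - nsq q =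
      \sum_j \sum_k 1 / 2 * nsq ((sigma ord0 j)%:C * z ord0 k ^+ 2 -
         (sigma ord0 k)%:C * z ord0 j ^+ 2).
    under [RHS]eq_bigr do rewrite -mulr_sumr.
    (* Lagrange's identity for the weights [sigma] and the squares [z_k^2]; its factor 2 cancels the
       factor [1 / 2]. *)
    rewrite -[RHS]mulr_sumr (nsq_lagrange (fun k => sigma ord0 k)
       (fun k => z ord0 k ^+ 2)) -peval_quad -/q mulrA mulfVK
       ?pnatr_eq0 // mul1r.
    by congr (_ * _ - _); apply: eq_bigr => k _; rewrite expr2 nsqM.
  apply: eq_bigr => j _; apply: eq_bigr => k _.
  rewrite /peval !mevalM mevalC mevalB !mevalM !mevalC.
  by rewrite !mevalXU nsqM nsq_real sq_half.
rewrite !nsq_1D complexReD.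
have -> : nsq (q + q) = 4 * nsq q by rewrite /nsq complexReD complexImD; ring.
by field.
Qed.

(** Cauchy-Schwarz, read off from the nonnegative side of Lagrange's identity, followed by bounding
    the sum of the [|z_k|^4] by the square of [rnsq z]. *)
Lemma nsq_quad_le z : nsq (peval Q z) <= S * rnsq z ^+ 2.
Proof.
have : 0 <= \sum_i \sum_j nsq ((sigma ord0 i)%:C * z ord0 j ^+ 2 -
    (sigma ord0 j)%:C * z ord0 i ^+ 2).
  by apply: sumr_ge0 => i _; apply: sumr_ge0 => j _; exact: nsq_ge0.
rewrite (nsq_lagrange (fun k => sigma ord0 k) (fun k => z ord0 k ^+ 2)).
rewrite -peval_quad pmulr_rge0 // subr_ge0 => /le_trans; apply.
apply: ler_wpM2l; first by apply: sumr_ge0 => k _; exact: sqr_ge0.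
rewrite expr2 {1}/rnsq mulr_suml; apply: ler_sum => k _.
rewrite expr2 nsqM ler_wpM2l ?nsq_ge0 // /rnsq (bigD1 k) //= lerDl.
by apply: sumr_ge0 => j _; exact: nsq_ge0.
Qed.

Lemma numerator_proper :
  S <= 1 / 16 -> rational_proper_map numerator (denominator sigma).
Proof.
move=> S_le; apply/rational_proper_mapP.
have S_le2 : S <= 1 / 2 by lra.
(* Here [|Q|^2 <= 1 / 16], so the real part of [Q] is at most [1 / 4] in absolute value; all three
   bounds follow linearly. *)
have main z : rnsq z < 1 -> let B := 1 + 2 * complex.Re (peval Q z) +
      2 * nsq (peval Q z) + rnsq z / 2 in
    [/\ 0 < B, B <= 3 & 1 / 2 <= nsq (1 + peval Q z)].
  move=> z1 B; rewrite nsq_1D.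
  have z0 := rnsq_ge0 z.
  have q16 : nsq (peval Q z) <= 1 / 16.
    apply: le_trans (nsq_quad_le z) _.
    have : rnsq z ^+ 2 <= 1 by rewrite expr_le1 // ltW.
    have : 0 <= S by apply: sumr_ge0 => k _; exact: sqr_ge0.
    by have := sqr_ge0 (rnsq z); nra.
  have q0 := nsq_ge0 (peval Q z).
  have re : complex.Re (peval Q z) ^+ 2 <= 1 / 16.
    by apply: le_trans q16; rewrite /nsq lerDl sqr_ge0.
  have [re1 re2] : - (1 / 4) <= complex.Re (peval Q z) /\
      complex.Re (peval Q z) <= 1 / 4.
    by split; nra.
  by split; rewrite /B; lra.
split=> [z z1|rho rho1].
  have [B0 _ _] := main _ z1.
  rewrite nsq_numerator // peval_denominator gtrBl mulr_gt0 // subr_gt0 //.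
(* If [|p|^2 <= rho |g|^2], the identity gives [(1 - rho) |g|^2 <= (1 - r) B <= 3 (1 - r)], and
   [|g|^2 >= 1 / 2] yields [1 - r >= (1 - rho) / 6]. *)
exists (1 - (1 - rho) / 6); split; first lra.
move=> z z1; have [B0 B3 g2] := main _ z1.
rewrite nsq_numerator // peval_denominator => h.
nra.
Qed.

Lemma msize_var k : (msize (X k) <= 2)%N.
Proof. by rewrite msizeX mdeg1. Qed.

Lemma msize_monomial2 (c : CC R) k : (msize (mpolyC n c * X k ^+ 2) <= 3)%N.
Proof.
rewrite expr2; apply: (@msizeM_bound _ _ _ _ 0 2); first exact: msizeC_bound.
by apply: (@msizeM_bound _ _ _ _ 1 1); exact: msize_var.
Qed.

Lemma msize_quad : (msize Q <= 3)%N.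
Proof.
apply: (leq_trans (msize_sum _ _ _)); apply/bigmax_leqP => k _.
exact: msize_monomial2.
Qed.

Lemma msize_denominator : (msize (denominator sigma) <= 3)%N.
Proof. by apply: msizeD_bound msize_quad; rewrite msize1. Qed.

Lemma numerator_deg : poly_map_deg_le 3 numerator.
Proof.
move=> j; rewrite /numerator; move: (enum_val j) => [[i|[i k]]|[i k]] /=;
    apply: (@msizeM_bound _ _ _ _ 0 3); rewrite ?msizeC_bound //.
- apply: (@msizeM_bound _ _ _ _ 1 2); rewrite ?msize_var //.
  exact: msizeD_bound msize_denominator msize_quad.
- apply: (@msizeM_bound _ _ _ _ 1 2); rewrite ?msize_var //.
  by rewrite ltnW ?ltnS ?msize_var.
- by apply: ltnW; apply: msizeD_bound; rewrite ?msizeN msize_monomial2.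
Qed.

Lemma numerator0 j : peval (numerator j) 0 = 0.
Proof.
have X0 k : meval (fun i => (0 : 'rV[CC R]_n) ord0 i) (X k) = 0.
  by rewrite mevalXU mxE.
rewrite /numerator /peval; move: (enum_val j) => [[i|[i k]]|[i k]] /=.
- by rewrite !mevalM X0 mul0r mulr0.
- by rewrite !mevalM X0 mul0r mulr0.
- by rewrite mevalM mevalB !mevalM !X0 !(mulr0, mul0r) subr0 mulr0.
Qed.

Lemma numerator_lowest_terms : lowest_terms numerator (denominator sigma).
Proof.
move=> d dg dp.
have gE : denominator sigma = 1 + Q by [].
have dX k : mpoly_dvd d (X k).
  have : mpoly_dvd d (X k * (1 + Q + Q)).
    have c0 : (Num.sqrt (1 / 2))%:C != 0 :> CC R.
      by rewrite (inj_eq (@complexI R)) gt_eqF // sqrtr_gt0; lra.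
    have := dp (enum_rank (inl (inl k) : numerator_index)).
    rewrite /numerator enum_rankK /=.
    (* The scalar [sqrt (1 / 2)] is removed by multiplying with its inverse. *)
    move=> /(mpoly_dvdMl (mpolyC n (Num.sqrt (1 / 2))%:C^-1)).
    by rewrite mulrA -mpolyCM mulVf // mpolyC1 mul1r.
  have := mpoly_dvdMl (2 * X k) dg => /mpoly_dvdB/[apply].
  by rewrite gE (_ : _ - _ = X k) //; ring.
have dQ : mpoly_dvd d Q.
  rewrite /Q; elim: (index_enum _) => [|k s IHs].
    by rewrite big_nil; exists 0; rewrite mulr0.
  rewrite big_cons -[X in mpoly_dvd d (_ + X)]opprK -[- \sum_(_ <- _) _]mulN1r.
  apply: mpoly_dvdB; last exact: mpoly_dvdMl.
  by rewrite expr2 mulrA; exact: mpoly_dvdMl.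
(* Subtracting [Q] from the denominator shows that [d] divides 1, and the units among the
   polynomials are constants. *)
have [r] := mpoly_dvdB dg dQ; rewrite gE addrK => dr.
have : d \is a GRing.unit by apply/unitrPr; exists r.
by move=> /andP[/eqP -> _]; eexists.
Qed.

End Existence.

(** * Definability of cubic proper numerators *)

Section Semialgebraicity.
Variable R : realType.

Definition cpolyfun (I : finType) (F : (I -> R) -> CC R) : Prop :=
  polyfun (fun x => complex.Re (F x)) /\ polyfun (fun x => complex.Im (F x)).

Section CPolyfun.
Variable I : finType.
Implicit Types F G : (I -> R) -> CC R.

Lemma cpolyfun_cst c : cpolyfun (fun _ : I -> R => c).
Proof. by split; exact: polyfun_cst. Qed.

Lemma cpolyfun_real (f : (I -> R) -> R) :
  polyfun f -> cpolyfun (fun x => (f x)%:C).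
Proof. by move=> fp; split => //=; exact: polyfun_cst. Qed.

Lemma cpolyfunD F G : cpolyfun F -> cpolyfun G -> cpolyfun (fun x => F x + G x).
Proof.
move=> [Fr Fi] [Gr Gi]; split.
  by under eq_fun do rewrite complexReD; exact: polyfunD.
by under eq_fun do rewrite complexImD; exact: polyfunD.
Qed.

Lemma cpolyfunM F G : cpolyfun F -> cpolyfun G -> cpolyfun (fun x => F x * G x).
Proof.
move=> [Fr Fi] [Gr Gi]; split.
  under eq_fun do rewrite complexReM.
  by apply: polyfunD; [|apply: polyfunN]; exact: polyfunM.
by under eq_fun do rewrite complexImM; apply: polyfunD; exact: polyfunM.
Qed.

Lemma cpolyfunX F k : cpolyfun F -> cpolyfun (fun x => F x ^+ k).
Proof.
move=> Fp; elim: k => [|k IHk].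
  by under eq_fun do rewrite expr0; exact: cpolyfun_cst.
by under eq_fun do rewrite exprS; exact: cpolyfunM.
Qed.

Lemma cpolyfun_sum (J : finType) (A : pred J) (F : J -> (I -> R) -> CC R) :
  (forall j, cpolyfun (F j)) -> cpolyfun (fun x => \sum_(j | A j) F j x).
Proof.
move=> Fp; elim: (index_enum J) => [|j s IHs].
  by under eq_fun do rewrite big_nil; exact: cpolyfun_cst.
by under eq_fun do rewrite big_cons; case: (A j) => //; exact: cpolyfunD.
Qed.

Lemma cpolyfun_prod (J : finType) (F : J -> (I -> R) -> CC R) :
  (forall j, cpolyfun (F j)) -> cpolyfun (fun x => \prod_j F j x).
Proof.
move=> Fp; elim: (index_enum J) => [|j s IHs].
  by under eq_fun do rewrite big_nil; exact: cpolyfun_cst.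
by under eq_fun do rewrite big_cons; exact: cpolyfunM.
Qed.

Lemma cpolyfun_reindex (J : finType) (h : I -> J) F :
  cpolyfun F -> cpolyfun (fun x : J -> R => F (x \o h)).
Proof.
by move=> [/(polyfun_reindex h) Fr /(polyfun_reindex h) Fi]; split.
Qed.

Lemma polyfun_nsq F : cpolyfun F -> polyfun (fun x => nsq (F x)).
Proof. by move=> [Fr Fi]; apply: polyfunD; exact: polyfunM. Qed.

Lemma definable_eqC F G :
  cpolyfun F -> cpolyfun G -> definable (fun x => F x = G x).
Proof.
move=> [Fr Fi] [Gr Gi].
have := definable_and (definable_eq Fr Gr) (definable_eq Fi Gi).
apply: definable_iff.
by move=> x; split=> [|->//]; case: (F x) (G x) => a b [c d] /= [-> ->].
Qed.

End CPolyfun.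

(** Codes complex unknowns by twice as many real ones, so that real quantifiers range over complex
    families; [true] marks the real part. *)
Definition complex_of (A : Type) (y : A * bool -> R) (a : A) : CC R :=
  Complex (y (a, true)) (y (a, false)).

Lemma complex_of_surj (A : Type) (c : A -> CC R) :
  exists y, c = complex_of y.
Proof.
exists (fun ab => if ab.2 then complex.Re (c ab.1) else complex.Im (c ab.1)).
by apply/funext => a; rewrite /complex_of /=; case: (c a).
Qed.

Lemma cpolyfun_complex_of (I A : finType) (a : A) :
  cpolyfun (fun v : I + A * bool -> R => complex_of (v \o inr) a).
Proof. by split; exact: polyfun_var. Qed.

Section CQuantifiers.
Variables I A : finType.
Variable P : (I -> R) -> (A -> CC R) -> Prop.
Hypothesis Pd : definable (fun v : I + A * bool -> R =>
  P (v \o inl) (complex_of (v \o inr))).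

Lemma definable_existsC : definable (fun x => exists c, P x c).
Proof.
have := definable_exists (P := fun x y => P x (complex_of y)) Pd.
apply: definable_iff.
move=> x; split=> [[y Py]|[c]]; first by exists (complex_of y).
by have [y ->] := complex_of_surj c; exists y.
Qed.

Lemma definable_forallC : definable (fun x => forall c, P x c).
Proof.
have := definable_forall (P := fun x y => P x (complex_of y)) Pd.
apply: definable_iff.
move=> x; split=> [h c|h y]; last exact: h.
by have [y ->] := complex_of_surj c.
Qed.

End CQuantifiers.

(** * Polynomials whose coefficients vary polynomially with parameters *)

Variable n : nat.

Definition mpolyfun (I : finType) (F : (I -> R) -> {mpoly (CC R)[n]}) : Prop :=
  forall m, cpolyfun (fun x => mcoeff m (F x)).

Section Mpolyfun.
Variable I : finType.
Implicit Types F G : (I -> R) -> {mpoly (CC R)[n]}.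

Lemma mpolyfun_cst p : mpolyfun (fun _ : I -> R => p).
Proof. by move=> m; exact: cpolyfun_cst. Qed.

Lemma mpolyfunC (f : (I -> R) -> CC R) :
  cpolyfun f -> mpolyfun (fun x => mpolyC n (f x)).
Proof.
move=> fp m; under eq_fun do rewrite mcoeffC.
by apply: cpolyfunM => //; exact: cpolyfun_cst.
Qed.

Lemma mpolyfunD F G : mpolyfun F -> mpolyfun G -> mpolyfun (fun x => F x + G x).
Proof.
by move=> Fp Gp m; under eq_fun do rewrite mcoeffD; exact: cpolyfunD.
Qed.

(** A coefficient of the product is a sum of products of coefficients over an index set that depends
    on the monomial only. *)
Lemma mpolyfunM F G : mpolyfun F -> mpolyfun G -> mpolyfun (fun x => F x * G x).
Proof.
move=> Fp Gp m; under eq_fun do rewrite mcoeffM.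
by apply: cpolyfun_sum => k; exact: cpolyfunM.
Qed.

Lemma mpolyfun_sum (J : finType) (F : J -> (I -> R) -> {mpoly (CC R)[n]}) :
  (forall j, mpolyfun (F j)) -> mpolyfun (fun x => \sum_j F j x).
Proof.
move=> Fp m; under eq_fun do rewrite raddf_sum.
by apply: cpolyfun_sum => j; exact: Fp.
Qed.

(** The uniform degree bound reduces equality of polynomials to finitely many coefficient
    equations. *)
Lemma definable_mpoly_eq F G k :
  (forall x, msize (F x) <= k)%N -> (forall x, msize (G x) <= k)%N ->
  mpolyfun F -> mpolyfun G -> definable (fun x => F x = G x).
Proof.
move=> Fk Gk Fp Gp.
have h (m : bmultinom n k) :
    definable (fun x => mcoeff m (F x) = mcoeff m (G x)).
  exact: definable_eqC.
apply: (definable_iff _ (definable_fin_forall h)) => x; split=> [FG|-> //].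
apply/mpolyP => m; have [km|mk] := leqP k (mdeg m); last first.
  exact: (FG (BMultinom mk)).
have out (p : {mpoly (CC R)[n]}) : (msize p <= k)%N -> mcoeff m p = 0.
  move=> pk; apply: memN_msupp_eq0; apply: msize_mdeg_ge.
  exact: leq_trans km.
by rewrite !out.
Qed.

End Mpolyfun.

(** [bmultinom n d] holds the monomials of degree strictly below [d], so cubics correspond to
    [d = 4]. *)
Definition poly_of_coef d (c : bmultinom n d -> CC R) : {mpoly (CC R)[n]} :=
  \sum_m mpolyC n (c m) * mpolyX (CC R) m.

Lemma poly_of_coef_msize d (c : bmultinom n d -> CC R) :
  (msize (poly_of_coef c) <= d)%N.
Proof.
apply: (leq_trans (msize_sum _ _ _)); apply/bigmax_leqP => m _.
by rewrite mul_mpolyC (leq_trans (msizeZ_le _ _)) // msizeX; exact: bmdeg.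
Qed.

Lemma poly_of_coef_surj d (p : {mpoly (CC R)[n]}) : (msize p <= d)%N ->
  p = poly_of_coef (fun m : bmultinom n d => mcoeff m p).
Proof.
move=> pd; rewrite {1}(mpolywE pd); apply: eq_bigr => m _.
by rewrite mul_mpolyC.
Qed.

Lemma mpolyfun_poly_of_coef (I : finType) d
    (c : (I -> R) -> bmultinom n d -> CC R) :
  (forall m, cpolyfun (c^~ m)) -> mpolyfun (fun x => poly_of_coef (c x)).
Proof.
move=> cp; apply: mpolyfun_sum => m.
by apply: mpolyfunM; [exact: mpolyfunC|exact: mpolyfun_cst].
Qed.

Lemma peval_poly_of_coef d (c : bmultinom n d -> CC R) (z : 'I_n -> CC R) :
  peval (poly_of_coef c) (\row_i z i) =
  \sum_m c m * \prod_i z i ^+ fun_of_multinom m i.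
Proof.
rewrite /peval raddf_sum; apply: eq_bigr => m _ /=.
rewrite mevalM mevalC mevalX; congr (_ * _).
by apply: eq_bigr => i _; rewrite mxE.
Qed.

Lemma mpolyfun_denominator (I : finType) (s : (I -> R) -> 'I_n -> R) :
  (forall k, polyfun (s^~ k)) ->
  mpolyfun (fun x => denominator (\row_k s x k)).
Proof.
move=> sp; apply: mpolyfunD; first exact: mpolyfun_cst.
apply: mpolyfun_sum => k; apply: mpolyfunM; last exact: mpolyfun_cst.
by apply/mpolyfunC/cpolyfun_real; under eq_fun do rewrite mxE.
Qed.

Lemma cpolyfun_peval_denominator (I : finType) (s : (I -> R) -> 'I_n -> R)
    (z : (I -> R) -> 'I_n -> CC R) :
  (forall k, polyfun (s^~ k)) -> (forall k, cpolyfun (z^~ k)) ->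
  cpolyfun (fun x => peval (denominator (\row_k s x k)) (\row_k z x k)).
Proof.
move=> sp zp; under eq_fun do rewrite peval_denominator peval_quad.
apply: cpolyfunD; first exact: cpolyfun_cst.
apply: cpolyfun_sum => k.
under eq_fun do rewrite !mxE.
apply: cpolyfunM; first exact: cpolyfun_real.
exact: cpolyfunX.
Qed.

Lemma cpolyfun_peval_poly_of_coef (I : finType) d
    (c : (I -> R) -> bmultinom n d -> CC R) (z : (I -> R) -> 'I_n -> CC R) :
  (forall m, cpolyfun (c^~ m)) -> (forall k, cpolyfun (z^~ k)) ->
  cpolyfun (fun x => peval (poly_of_coef (c x)) (\row_k z x k)).
Proof.
move=> cp zp; under eq_fun do rewrite peval_poly_of_coef.
apply: cpolyfun_sum => m; apply: cpolyfunM; first exact: cp.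
by apply: cpolyfun_prod => k; exact: cpolyfunX.
Qed.

Lemma msize_factor (p q : {mpoly (CC R)[n]}) :
  p * q != 0 -> (msize p <= msize (p * q))%N.
Proof.
rewrite mulf_eq0 negb_or => /andP[p0 q0]; rewrite msizeM //.
by rewrite [msize q]mpolySpred // addnS leq_addr.
Qed.

Lemma bounded_cofactor d (a q : {mpoly (CC R)[n]}) :
  (msize q <= d)%N -> a != 0 -> mpoly_dvd a q ->
  exists b : bmultinom n d -> CC R, q = a * poly_of_coef b.
Proof.
move=> qd a0 [r qE]; have rd : (msize r <= d)%N.
  have [r0|r0] := eqVneq r 0; first by rewrite r0 msize0.
  by apply: leq_trans qd; rewrite qE mulrC msize_factor // mulf_neq0.
by exists (fun m => mcoeff m r); rewrite -poly_of_coef_surj.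
Qed.

(** Degrees add in a product of nonzero polynomials, so a divisor of the nonzero [g], and its
    cofactors, have bounded degree: quantifying over finitely many coefficients is enough. The
    constant is a family over [unit] to fit [definable_existsC]. *)
Lemma lowest_termsP N d (p : 'I_N -> {mpoly (CC R)[n]}) g :
  g != 0 -> (msize g <= d)%N -> (forall j, msize (p j) <= d)%N ->
  lowest_terms p g <->
  (forall a : bmultinom n d -> CC R,
     (exists b : bmultinom n d -> CC R, g = poly_of_coef a * poly_of_coef b) ->
     (forall j, exists b : bmultinom n d -> CC R,
        p j = poly_of_coef a * poly_of_coef b) ->
     exists c : unit -> CC R, poly_of_coef a = mpolyC n (c tt)).
Proof.
move=> g0 gd pd; split=> [low a [b gE] pE|h a ag ap].
  have [||c ->] := low (poly_of_coef a); last by exists (fun=> c).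
    by exists (poly_of_coef b).
  by move=> j; have [b' ->] := pE j; exists (poly_of_coef b').
have a0 : a != 0.
  by case: ag g0 => r ->; apply: contra_neq => ->; rewrite mul0r.
have aE : a = poly_of_coef (fun m : bmultinom n d => mcoeff m a).
  apply: poly_of_coef_surj; apply: leq_trans gd.
  by case: ag g0 => r ->; exact: msize_factor.
have [||c] := h (fun m => mcoeff m a); rewrite -?aE.
- exact: bounded_cofactor.
- by move=> j; exact: bounded_cofactor.
- by move=> ->; exists (c tt).
Qed.

Lemma denominator_neq0 (sigma : 'rV[R]_n) : denominator sigma != 0.
Proof.
apply/eqP => /(congr1 (fun q => peval q 0)).
rewrite peval_denominator peval_quad /peval meval0 big1 ?addr0.
  by move/eqP; rewrite oner_eq0.
by move=> k _; rewrite mxE expr0n mulr0.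
Qed.

(** * Definability of the conditions on a parametrized cubic numerator *)

Section DefinableProper.
Variables (I : finType) (N : nat).
Variable s : (I -> R) -> 'I_n -> R.
Variable c : (I -> R) -> 'I_N * bmultinom n 4 -> CC R.
Hypothesis s_poly : forall k, polyfun (s^~ k).
Hypothesis c_poly : forall a, cpolyfun (c^~ a).

Let p x (j : 'I_N) := poly_of_coef (fun m => c x (j, m)).
Let g x := denominator (\row_k s x k).

Lemma definable_lowest_terms : definable (fun x => lowest_terms (p x) (g x)).
Proof.
have p_msize x j : (msize (p x j) <= 4)%N by exact: poly_of_coef_msize.
have g_msize x : (msize (g x) <= 4)%N.
  by apply: leq_trans (msize_denominator _) _.
(* Two factors of degree at most 3 have a product of degree at most 6, that is, [msize] at most
   7. *)
have prod_msize (a b : bmultinom n 4 -> CC R) :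
    (msize (poly_of_coef a * poly_of_coef b) <= 7)%N.
  by apply: (@msizeM_bound _ _ _ _ 3 3); exact: poly_of_coef_msize.
apply: definable_iff.
  move=> x; apply: iff_sym; apply: lowest_termsP => //.
  exact: denominator_neq0.
apply: definable_forallC; apply: definable_imp; last apply: definable_imp.
- apply: definable_existsC; apply: (@definable_mpoly_eq _ _ _ 7) => //.
  + by move=> x; apply: leq_trans (g_msize _) _.
  + apply: mpolyfun_denominator => k.
    exact: (polyfun_reindex (inl \o inl) (s_poly k)).
  + apply: mpolyfunM; apply: mpolyfun_poly_of_coef => m.
      exact: (cpolyfun_reindex inl (cpolyfun_complex_of I m)).
    exact: cpolyfun_complex_of.
- apply: definable_fin_forall => j.
  apply: definable_existsC; apply: (@definable_mpoly_eq _ _ _ 7) => //.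
  + by move=> x; apply: leq_trans (p_msize _ _) _.
  + apply: mpolyfun_poly_of_coef => m.
    exact: (cpolyfun_reindex (inl \o inl) (c_poly (j, m))).
  + apply: mpolyfunM; apply: mpolyfun_poly_of_coef => m.
      exact: (cpolyfun_reindex inl (cpolyfun_complex_of I m)).
    exact: cpolyfun_complex_of.
- apply: definable_existsC; apply: (@definable_mpoly_eq _ _ _ 4).
  + by move=> x; exact: poly_of_coef_msize.
  + by move=> x; exact: msizeC_bound.
  + apply: mpolyfun_poly_of_coef => m.
    exact: (cpolyfun_reindex inl (cpolyfun_complex_of I m)).
  + exact/mpolyfunC/cpolyfun_complex_of.
Qed.

Lemma row_entries (z : 'rV[CC R]_n) : z = \row_k z ord0 k.
Proof. by apply/rowP => k; rewrite mxE. Qed.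

Lemma definable_rational_proper :
  definable (fun x => rational_proper_map (p x) (g x)).
Proof.
pose r (z : 'I_n -> CC R) := rnsq (\row_k z k).
pose np x z := \sum_j nsq (peval (p x j) (\row_k z k)).
pose ng x z := nsq (peval (g x) (\row_k z k)).
have rp (J : finType) (z : (J -> R) -> 'I_n -> CC R) :
    (forall k, cpolyfun (z^~ k)) -> polyfun (fun x => r (z x)).
  move=> zp; rewrite /r /rnsq; apply: polyfun_sum => k.
  by under eq_fun do rewrite mxE; exact: polyfun_nsq.
have npp (J : finType) (h : I -> J) (z : (J -> R) -> 'I_n -> CC R) :
    (forall k, cpolyfun (z^~ k)) -> polyfun (fun x => np (x \o h) (z x)).
  move=> zp; apply: polyfun_sum => j.
  apply/polyfun_nsq/cpolyfun_peval_poly_of_coef => // m.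
  exact: (cpolyfun_reindex h (c_poly (j, m))).
have ngp (J : finType) (h : I -> J) (z : (J -> R) -> 'I_n -> CC R) :
    (forall k, cpolyfun (z^~ k)) -> polyfun (fun x => ng (x \o h) (z x)).
  move=> zp; apply/polyfun_nsq/cpolyfun_peval_denominator => // k.
  exact: (polyfun_reindex h (s_poly k)).
apply: (@definable_iff _ _ (fun x =>
  (forall z, r z < 1 -> np x z < ng x z) /\
  (forall rho : R, rho < 1 -> exists t : R, t < 1 /\
     forall z, r z < 1 -> np x z <= rho * ng x z -> r z <= t))).
  move=> x; rewrite rational_proper_mapP; split=> -[h1 h2]; split.
  - by move=> z; rewrite (row_entries z); exact: h1.
  - move=> rho /h2[t [t1 ht]]; exists t; split=> // z.
    by rewrite (row_entries z); exact: ht.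
  - by move=> z; exact: h1.
  - by move=> rho /h2[t [t1 ht]]; exists t; split=> // z; exact: ht.
apply: definable_and.
  apply: definable_forallC; apply: definable_imp.
    apply: definable_lt; last exact: polyfun_cst.
    by apply: rp => k; exact: cpolyfun_complex_of.
  by apply: definable_lt; [apply: npp|apply: ngp] => k;
    exact: cpolyfun_complex_of.
apply: definable_forall1; apply: definable_imp.
  by apply: definable_lt; [exact: polyfun_var|exact: polyfun_cst].
apply: definable_exists1; apply: definable_and.
  by apply: definable_lt; [exact: polyfun_var|exact: polyfun_cst].
apply: definable_forallC; apply: definable_imp; last apply: definable_imp.
- apply: definable_lt; last exact: polyfun_cst.
  by apply: rp => k; exact: cpolyfun_complex_of.
- apply: definable_le.
    (* The context now also holds [rho], the bound [t] and the point [z]; three injections lead back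
       to the parameters. *)
    by apply: (npp _ (inl \o (inl \o inl))) => k; exact: cpolyfun_complex_of.
  apply: polyfunM; first exact: polyfun_var.
  by apply: (ngp _ (inl \o (inl \o inl))) => k; exact: cpolyfun_complex_of.
- apply: definable_le; last exact: polyfun_var.
  by apply: rp => k; exact: cpolyfun_complex_of.
Qed.

Lemma definable_cubic_proper_numerator :
  definable (fun x => cubic_proper_numerator (\row_k s x k) (p x)).
Proof.
apply: (@definable_iff _ _ (fun x => (forall j, peval (p x j) (\row_k 0) = 0) /\
  (rational_proper_map (p x) (g x) /\ lowest_terms (p x) (g x)))).
  have -> : \row_k 0 = 0 :> 'rV[CC R]_n by apply/rowP => k; rewrite !mxE.
  move=> x; split=> [[p0 [pg low]]|[_ p0 pg low]] //; split=> // j.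
  exact: poly_of_coef_msize.
apply: definable_and.
  apply: definable_fin_forall => j.
  apply: definable_eqC; last exact: cpolyfun_cst.
  by apply: cpolyfun_peval_poly_of_coef => // k; exact: cpolyfun_cst.
apply: definable_and; first exact: definable_rational_proper.
exact: definable_lowest_terms.
Qed.

End DefinableProper.

Lemma semialgebraic_cubic_proper (N : nat) :
  semialgebraic [set sigma : 'rV[R]_n | nonneg_nondecreasing sigma /\
    exists p : 'I_N -> {mpoly (CC R)[n]}, cubic_proper_numerator sigma p].
Proof.
(* The unknown cubic map is replaced by its finitely many complex coefficients. *)
pose P (s : 'I_n -> R) :=
  ((forall k, 0 <= s k) /\ (forall j k : 'I_n, (j <= k)%N -> s j <= s k)) /\
  exists c : 'I_N * bmultinom n 4 -> CC R,
    cubic_proper_numerator (\row_k s k)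
      (fun j => poly_of_coef (fun m => c (j, m))).
rewrite (_ : [set _ | _] = [set sigma : 'rV[R]_n | P (fun k => sigma ord0 k)]).
  apply: (@definable_semialgebraic R n P); apply: definable_and.
    apply: definable_and; apply: definable_fin_forall => j.
      by apply: definable_le; [exact: polyfun_cst|exact: polyfun_var].
    apply: definable_fin_forall => k.
    (* The comparison of the indices does not depend on the point, so it is a constant formula. *)
    apply: definable_imp; first exact: definable_cst.
    by apply: definable_le; exact: polyfun_var.
  apply: definable_existsC.
  apply: (@definable_cubic_proper_numerator _ _ (fun v => v \o inl)
    (fun v => complex_of (v \o inr))) => [k|a]; first exact: polyfun_var.
  exact: cpolyfun_complex_of.
have rE (sigma : 'rV[R]_n) : \row_k sigma ord0 k = sigma.
  by apply/rowP => k; rewrite mxE.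
apply/seteqP; split=> sigma /= [h [p hp]]; (split; first exact: h).
  exists (fun jm : 'I_N * bmultinom n 4 => mcoeff jm.2 (p jm.1)); rewrite rE.
  have -> // : (fun j =>
      poly_of_coef (fun m : bmultinom n 4 => mcoeff m (p j))) = p.
  by apply/funext => j; rewrite -poly_of_coef_surj //; case: hp.
by rewrite rE in hp; eexists; exact: hp.
Qed.

End Semialgebraicity.

Theorem proposition5p1 (R : realType) (n : nat) (n_gt0 : (0 < n)%N) :
  exists (N : nat) (eps : R), 0 < eps /\
    (forall sigma : 'rV[R]_n,
       nonneg_nondecreasing sigma -> (forall k, sigma ord0 k < eps) ->
       exists p : 'I_N -> {mpoly (CC R)[n]}, cubic_proper_numerator sigma p) /\
    semialgebraic
      [set sigma : 'rV[R]_n |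
         nonneg_nondecreasing sigma /\
         exists p : 'I_N -> {mpoly (CC R)[n]}, cubic_proper_numerator sigma p].
Proof.
(* With [sigma_k < 1 / (4 n)] the sum of the squares is at most [n / (16 n^2) = 1 / (16 n)], within
   the bound [1 / 16] of [numerator_proper]. *)
exists #|numerator_index n|, (1 / (4 * n%:R)).
have n0 : 0 < n%:R :> R by rewrite ltr0n.
have n1 : 1 <= n%:R :> R by rewrite ler1n.
split; first by rewrite divr_gt0 ?mulr_gt0.
split; last exact: semialgebraic_cubic_proper.
move=> sigma [s0 _] s_lt; exists (numerator sigma).
split; [exact: numerator_deg|exact: numerator0| |exact: numerator_lowest_terms].
apply: numerator_proper.
have : \sum_k sigma ord0 k ^+ 2 <= \sum_(k < n) (1 / (4 * n%:R)) ^+ 2.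
  apply: ler_sum => k _.
  by rewrite ler_sqr ?nnegrE ?s0 ?divr_ge0 ?mulr_ge0 ?ler0n //; apply: ltW.
move=> /le_trans; apply.
rewrite sumr_const card_ord -[leLHS]mulr_natr.
have -> : (1 / (4 * n%:R)) ^+ 2 * n%:R = 1 / 16 / n%:R :> R.
  by field; rewrite gt_eqF.
by rewrite ler_pdivrMr // ler_peMr.
Qed.
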